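(* Let $X$ be a compact, connected, oriented Riemannian surface. For any traceless symbol $\sigma:T^*X\to S^2_0(TX)$ we can find unique sections $v:X\to TX$ and $w:X\to(TX)^3$ such that for every $x\in X$ the restriction of $\sigma$ to $T_x^*X$ equals $\Phi(v(x)\oplus w(x))$. In this case we have that $$\mathcal S_\sigma=\{x\in X\mid |w(x)/v(x)|=1\}$$ and $$\mathcal M_\sigma=\bigcup_{x\in\mathcal S_\sigma}\left\{z^\flat\in T^*_xX\;\middle|\; z\in T_xX\text{ and }z^2=\frac{w(x)}{v(x)}\right\}.$$
   Context: $TX$ is an $SO(2)=U(1)$ bundle, hence a complex line bundle with Hermitian norm; $i$ is rotation by $+\pi/2$. For $n>0$, $(TX)^n$ is the $n$-fold complex tensor power, with norm satisfying $|ab|=|a||b|$ (products are tensor products over $\mathbb C$); $(TX)^{-n}$ is the $n$-th tensor power of the conjugate bundle, and $(TX)^0=X\times\mathbb C$. For $0\neq a\in T_xX$, $a^{-1}\in(TX)^{-1}_x$ is the unique element with $aa^{-1}=1$, and $b/a=ba^{-1}$. $\flat:TX\to T^*X$ is the metric isomorphism and $T^*X$ has the induced metric. $S^2_0(TX)$ is the bundle of traceless endomorphisms of $TX$ that are symmetric for the metric. A traceless symbol is a smooth real vector bundle morphism $\sigma:T^*X\to S^2_0(TX)$. The real vector bundle isomorphism $\Phi:TX\oplus(TX)^3\to\mathrm{Hom}(T^*X,S_0^2(TX))$ is given as follows: choosing an oriented orthonormal basis $e_1,e_2=ie_1$ of $T_xX$ and writing $v=(a+ib)e_1$, $w=(\alpha+i\beta)e_1^3$,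 the map $\Phi(v\oplus w)$ sends $\xi=\xi_1e_1^\flat+\xi_2e_2^\flat$ to the endomorphism with matrix, in the basis $e_1,e_2$, $$\begin{pmatrix} p_1 & q_1 \\ q_1 & -p_1 \end{pmatrix}\xi_1+\begin{pmatrix} p_2 & q_2 \\ q_2 & -p_2 \end{pmatrix}\xi_2,\qquad (p_1,q_1,p_2,q_2)=\tfrac1{\sqrt2}(a-\alpha,\;b-\beta,\;-b-\beta,\;a+\alpha);$$ this is independent of the chosen basis. Singular set: $\mathcal S_\sigma=\{x\in X\mid\sigma|_{T^*_xX}\text{ has non-zero kernel}\}$. Multiplicity set: $\mathcal M_\sigma=\{\xi\in S(T^*X)\mid\sigma(\xi)=0\}$, where $S(T^*X)$ is the unit cosphere bundle (equivalently, the set of unit covectors where the two eigenvalues of $\sigma(\xi)$ coincide).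
   Formalization: Since w(x)/v(x) is undefined where v(x)=0, the two formulas are stated for v(x)≠0, and the points with v(x)=w(x)=0 are added to the singular set and all unit covectors over them to the multiplicity set (for σ=0 the original equalities fail). *)

(* Defs.v *)
From HB Require Import structures.
From mathcomp Require Import all_boot all_order all_algebra.
From mathcomp Require Import all_classical all_reals all_analysis.
From mathcomp Require Import complex.
From mathcomp Require Import ring lra.

Set Implicit Arguments.
Unset Strict Implicit.
Unset Printing Implicit Defensive.

Import Order.TTheory GRing.Theory Num.Theory.
Import numFieldNormedType.Exports.

Import ComplexField.Normc.

Local Open Scope classical_set_scope.
Local Open Scope complex_scope.
Local Open Scope ring_scope.

(* Conventions: real tangent vectors are row vectors 'rV[R]_2, endomorphisms
   are matrices acting on the right (u *m A), covectors are column vectors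
   (xi sends u to (u *m xi) 0 0), and R^2 carries its standard orientation. *)

Section Plane.
Variable R : realType.
Local Notation C := R[i].

Record inner := Inner {
  gram :> 'M[R]_2;
  gram_sym : gram^T = gram;
  gram_pos : forall u : 'rV[R]_2, u != 0 -> 0 < (u *m gram *m u^T) 0 0 }.

Definition mx2 (a b c d : R) : 'M[R]_2 :=
  \matrix_(i, j) (if i == 0 then if j == 0 then a else b
                  else if j == 0 then c else d).

Variable G : inner.

Definition ip (u v : 'rV[R]_2) : R := (u *m G *m v^T) 0 0.

(* Rotation by +pi/2; see rot_ortho, rot_isometry and rot_oriented. *)
Definition rot : 'M[R]_2 :=
  (Num.sqrt (\det (G : 'M[R]_2)))^-1 *:
    mx2 (- G 0 1) (G 0 0) (- G 1 1) (G 0 1).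

Lemma gram10 : G 1 0 = G 0 1.
Proof. by rewrite -[in LHS](gram_sym G) mxE. Qed.

Lemma ord2P (P : 'I_2 -> Prop) : P 0 -> P 1 -> forall i, P i.
Proof.
move=> P0 P1 i; case: (unliftP 0 i) => [j ->|-> //].
by rewrite (ord1 j); congr P: P1; apply: val_inj.
Qed.

Lemma sum2 (V : nmodType) (F : 'I_2 -> V) : \sum_i F i = F 0 + F 1.
Proof. by rewrite big_ord_recl big_ord1; congr (_ + F _); apply: val_inj. Qed.

Lemma det2 (A : 'M[R]_2) : \det A = A 0 0 * A 1 1 - A 0 1 * A 1 0.
Proof.
rewrite (expand_det_row _ 0) sum2 /cofactor !det_mx11 !mxE /=.
have -> : lift (0 : 'I_2) (0 : 'I_1) = 1 by apply: val_inj.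
have -> : lift (1 : 'I_2) (0 : 'I_1) = 0 by apply: val_inj.
by rewrite /= expr0 expr1; ring.
Qed.

Lemma gram_det : \det (G : 'M[R]_2) = G 0 0 * G 1 1 - G 0 1 ^+ 2.
Proof. by rewrite det2 gram10 expr2. Qed.

Lemma ipE u v : ip u v =
  u 0 0 * v 0 0 * G 0 0 + (u 0 0 * v 0 1 + u 0 1 * v 0 0) * G 0 1
  + u 0 1 * v 0 1 * G 1 1.
Proof. by rewrite /ip !mxE sum2 !mxE !sum2 gram10; ring. Qed.

Lemma rotE0 (u : 'rV[R]_2) : (u *m rot) 0 0 =
  - (Num.sqrt (\det (G : 'M[R]_2)))^-1 * (u 0 0 * G 0 1 + u 0 1 * G 1 1).
Proof. by rewrite !mxE sum2 !mxE /=; ring. Qed.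

Lemma rotE1 (u : 'rV[R]_2) : (u *m rot) 0 1 =
  (Num.sqrt (\det (G : 'M[R]_2)))^-1 * (u 0 0 * G 0 0 + u 0 1 * G 0 1).
Proof. by rewrite !mxE sum2 !mxE /=; ring. Qed.

Lemma ip_gt0 (u : 'rV[R]_2) : u != 0 -> 0 < ip u u.
Proof. exact: gram_pos. Qed.

Lemma row2P (u v : 'rV[R]_2) : u 0 0 = v 0 0 -> u 0 1 = v 0 1 -> u = v.
Proof. by move=> e0 e1; apply/rowP; apply: ord2P. Qed.

Lemma gram00_gt0 : 0 < G 0 0.
Proof.
have /ip_gt0 : (\row_j (j == 0)%:R : 'rV[R]_2) != 0.
  by apply/eqP => /rowP/(_ 0)/eqP; rewrite !mxE oner_eq0.
by rewrite ipE !mxE /=; congr (_ < _); ring.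
Qed.

Lemma gram_det_gt0 : 0 < \det (G : 'M[R]_2).
Proof.
pose u : 'rV[R]_2 := \row_j (if j == 0 then - G 0 1 else G 0 0).
have /ip_gt0 : u != 0.
  apply/eqP => /rowP/(_ 1)/eqP; rewrite !mxE /= => /eqP h.
  by have := gram00_gt0; rewrite h ltxx.
rewrite ipE !mxE /= gram_det.
rewrite (_ : _ + _ = G 0 0 * (G 0 0 * G 1 1 - G 0 1 ^+ 2)); last by ring.
by rewrite pmulr_rgt0 // gram00_gt0.
Qed.

Local Notation s := (Num.sqrt (\det (G : 'M[R]_2))).
Lemma gram_sqrt_sqr : s ^+ 2 = G 0 0 * G 1 1 - G 0 1 ^+ 2.
Proof. by rewrite sqr_sqrtr ?gram_det // -gram_det ltW // gram_det_gt0. Qed.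
Lemma gram_sqrt_neq0 : s != 0.
Proof. by rewrite gt_eqF // sqrtr_gt0 gram_det_gt0. Qed.

Lemma rot_sqr (u : 'rV[R]_2) : u *m rot *m rot = - u.
Proof.
apply: row2P.
  rewrite rotE0 rotE0 rotE1 mxE.
  rewrite [LHS](_ : _ = - (u 0 0 * (s^-1) ^+ 2 * (G 0 0 * G 1 1 - G 0 1 ^+ 2)));
    last by ring.
  rewrite -gram_sqrt_sqr -mulrA -exprMn mulVf ?gram_sqrt_neq0 //.
  by rewrite expr1n mulr1.
rewrite rotE1 rotE0 rotE1 mxE.
rewrite [LHS](_ : _ = - (u 0 1 * (s^-1) ^+ 2 * (G 0 0 * G 1 1 - G 0 1 ^+ 2)));
  last by ring.
by rewrite -gram_sqrt_sqr -mulrA -exprMn mulVf ?gram_sqrt_neq0 // expr1n mulr1.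
Qed.

Lemma ip_rot u v : ip u (v *m rot) = s * (u 0 1 * v 0 0 - u 0 0 * v 0 1).
Proof.
rewrite ipE rotE0 rotE1.
rewrite [LHS](_ : _ = s^-1 * (G 0 0 * G 1 1 - G 0 1 ^+ 2) *
  (u 0 1 * v 0 0 - u 0 0 * v 0 1)); last by ring.
by rewrite -gram_sqrt_sqr expr2 mulKf ?gram_sqrt_neq0.
Qed.

Lemma ipC u v : ip u v = ip v u.
Proof. by rewrite !ipE; ring. Qed.

Lemma rot_ortho u : ip u (u *m rot) = 0.
Proof. by rewrite ip_rot; ring. Qed.

Lemma rot_isometry u v : ip (u *m rot) (v *m rot) = ip u v.
Proof.
rewrite ip_rot rotE0 rotE1 ipE -[RHS]mul1r -(mulfV gram_sqrt_neq0); ring.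
Qed.

Lemma rot_oriented (u : 'rV[R]_2) : u != 0 ->
  0 < u 0 0 * (u *m rot) 0 1 - u 0 1 * (u *m rot) 0 0.
Proof.
move=> u0; rewrite rotE0 rotE1.
rewrite (_ : _ - _ = s^-1 * ip u u); last by rewrite ipE; ring.
by rewrite mulr_gt0 ?ip_gt0 // invr_gt0 lt0r gram_sqrt_neq0 sqrtr_ge0.
Qed.

(* The plane as a complex line, i acting by rot. *)
Definition cplane of inner : Type := 'rV[R]_2.
Local Notation L := (cplane G).
HB.instance Definition _ := GRing.Zmodule.copy L 'rV[R]_2.

Definition cscale (c : C) (u : L) : L :=
  complex.Re c *: (u : 'rV[R]_2) + complex.Im c *: ((u : 'rV[R]_2) *m rot).

Lemma cscaleA a b u : cscale a (cscale b u) = cscale (a * b) u.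
Proof.
case: a b => a1 a2 [b1 b2]; rewrite /cscale /= mulmxDl -!scalemxAl rot_sqr.
by apply/rowP => i; rewrite !mxE; ring.
Qed.
Lemma cscale1 : left_id 1 cscale.
Proof. by move=> u; rewrite /cscale /= scale1r scale0r addr0. Qed.
Lemma cscaleDr : right_distributive cscale +%R.
Proof.
move=> [a b] u v; rewrite /cscale /= mulmxDl.
by apply/rowP => i; rewrite !mxE; ring.
Qed.
Lemma cscaleDl u : {morph cscale^~ u : a b / a + b}.
Proof.
move=> [a1 a2] [b1 b2]; rewrite /cscale /=.
by apply/rowP => i; rewrite !mxE; ring.
Qed.
HB.instance Definition _ := GRing.Zmodule_isLmodule.Build C L
  cscaleA cscale1 cscaleDr cscaleDl.

(* The Hermitian form, complex linear in its first argument. *)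
Definition hform (u v : L) : C := ip u v +i* ip u ((v : 'rV_2) *m rot).

Definition hcov_fun (v u : L) : C^o := hform u v.

Lemma hformDZl c x y v : hform (cscale c x + y) v = c * hform x v + hform y v.
Proof.
case: c => a b; rewrite /hform /cscale /= !ip_rot.
simpc; congr (_ +i* _); rewrite !ipE !mxE !sum2 !mxE /=.
  rewrite [LHS](_ : _ = a * ip x v + b * s^-1 *
    (G 0 0 * G 1 1 - G 0 1 ^+ 2) * (x 0 0 * v 0 1 - x 0 1 * v 0 0) + ip y v);
    last by rewrite !ipE; ring.
  rewrite -gram_sqrt_sqr expr2 -(mulrA b) (mulrA s^-1).
  by rewrite mulVf ?gram_sqrt_neq0 // mul1r !ipE; ring.
rewrite [LHS](_ : _ = a * (s * (x 0 1 * v 0 0 - x 0 0 * v 0 1)) +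
  b * (s * s^-1) * ip x v + s * (y 0 1 * v 0 0 - y 0 0 * v 0 1));
  last by rewrite !ipE; ring.
by rewrite mulfV ?gram_sqrt_neq0 // mulr1 !ipE; ring.
Qed.

Lemma hcov_fun_linear v : linear (hcov_fun v).
Proof. by move=> c x y; exact: hformDZl. Qed.
HB.instance Definition _ v := GRing.isLinear.Build C L C^o *:%R
  (hcov_fun v) (hcov_fun_linear v).

Lemma hform_scale (e u : L) : hform u e *: e = (ip e e *: (u : 'rV[R]_2) : L).
Proof.
rewrite /hform [LHS]/(cscale _ _) /cscale /= ip_rot.
apply: row2P; rewrite mxE ![(_ *: _ : 'rV_2) _ _]mxE (rotE0, rotE1).
  rewrite [LHS](_ : _ = ip u e * e 0 0 - (s * s^-1) *
    (u 0 1 * e 0 0 - u 0 0 * e 0 1) * (e 0 0 * G 0 1 + e 0 1 * G 1 1));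
    last by ring.
  by rewrite mulfV ?gram_sqrt_neq0 // !ipE; ring.
rewrite [LHS](_ : _ = ip u e * e 0 1 + (s * s^-1) *
  (u 0 1 * e 0 0 - u 0 0 * e 0 1) * (e 0 0 * G 0 0 + e 0 1 * G 0 1));
  last by ring.
by rewrite mulfV ?gram_sqrt_neq0 // !ipE; ring.
Qed.

Lemma hformK (e u : L) : ip e e = 1 -> hform u e *: e = u.
Proof. by rewrite hform_scale => ->; exact: (scale1r (u : 'rV[R]_2)). Qed.

Lemma hformC u v : hform u v = (hform v u)^*.
Proof.
by rewrite /hform /= ipC !ip_rot; congr (_ +i* _); ring.
Qed.

(* A positively oriented orthonormal basis is (e, i e) with e a unit vector. *)
Definition unit0 : L :=
  (Num.sqrt (G 0 0))^-1 *: (\row_j (j == 0)%:R : 'rV[R]_2).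

Lemma unit0P : ip unit0 unit0 = 1.
Proof.
rewrite ipE !mxE /= !mulr1 !mulr0 !mul0r !addr0 -expr2 exprVn.
by rewrite mul0r addr0 sqr_sqrtr ?mulVf ?gt_eqF ?ltW ?gram00_gt0.
Qed.

Lemma hform_unit (e : L) : ip e e = 1 -> hform e e = 1.
Proof. by move=> e1; rewrite /hform e1 rot_ortho. Qed.

Lemma cplane_vect_iso : Vector.axiom 1 L.
Proof.
exists (fun u => const_mx (hcov_fun unit0 u : C)).
  by move=> a u v; apply/rowP => j; rewrite !mxE linearP.
exists (fun r : 'rV[C]_1 => r 0 0 *: unit0) => [u|r].
  by rewrite mxE hformK ?unit0P.
apply/rowP => j; rewrite (ord1 j) !mxE linearZ /=.
by rewrite [hcov_fun _ _]hform_unit ?unit0P // [LHS]mulr1.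
Qed.
HB.instance Definition _ := Lmodule_hasFinDim.Build C L cplane_vect_iso.

End Plane.

(* For finite-dimensional V the tensor product of L and V is modelled as
   Hom(L^*, V), the pure tensor z (x) t being f |-> f z *: t; tpow n is the
   n-fold tensor power of L over K and texp n z the power z^n. *)
Section Tensor.
Variables (K : fieldType) (L : vectType K).

Fixpoint tpow (n : nat) : vectType K :=
  if n is m.+1 then 'Hom('Hom(L, K^o), tpow m) else K^o.

Definition tpure_fun (V : vectType K) (z : L) (t : V) (f : 'Hom(L, K^o)) : V :=
  (f z : K) *: t.

Lemma tpure_fun_linear (V : vectType K) z (t : V) : linear (tpure_fun z t).
Proof. by move=> a f h; rewrite /tpure_fun lfunE /= lfunE scalerDl scalerA. Qed.
HB.instance Definition _ (V : vectType K) z t :=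
  GRing.isLinear.Build K 'Hom(L, K^o) V *:%R
    (@tpure_fun V z t) (@tpure_fun_linear V z t).

Definition tpure (V : vectType K) (z : L) (t : V) : 'Hom('Hom(L, K^o), V) :=
  linfun (@tpure_fun V z t).

Fixpoint texp (n : nat) (z : L) : tpow n :=
  if n is m.+1 then tpure z (texp m z) else (1 : K^o).

End Tensor.

Section HermitianPowers.
Variables (R : realType) (G : inner R).
Local Notation C := R[i].
Local Notation L := (cplane G).

Definition hcov (v : L) : 'Hom(L, C^o) := linfun (hcov_fun v).

(* The conjugate line: the same group, with scalars acting by conjugates. *)
Definition conj_plane : Type := L.
HB.instance Definition _ := GRing.Zmodule.copy conj_plane L.

Definition conj_scale (c : C) (u : conj_plane) : conj_plane := c^* *: (u : L).
Lemma conj_scaleA a b u : conj_scale a (conj_scale b u) = conj_scale (a * b) u.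
Proof. by rewrite /conj_scale scalerA rmorphM. Qed.
Lemma conj_scale1 : left_id 1 conj_scale.
Proof. by move=> u; rewrite /conj_scale rmorph1 scale1r. Qed.
Lemma conj_scaleDr : right_distributive conj_scale +%R.
Proof. by move=> a u v; rewrite /conj_scale scalerDr. Qed.
Lemma conj_scaleDl u : {morph conj_scale^~ u : a b / a + b}.
Proof. by move=> a b; rewrite /conj_scale rmorphD scalerDl. Qed.
HB.instance Definition _ := GRing.Zmodule_isLmodule.Build C conj_plane
  conj_scaleA conj_scale1 conj_scaleDr conj_scaleDl.

(* The product of L^(n+1) with the conjugate line, with values in L^n: the
   Hermitian form pairs one factor L with the conjugate line.  On L itself the
   product of a and u is hform a u. *)
Definition contr n (t : tpow L n.+1) (u : conj_plane) : tpow L n := t (hcov u).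

(* The inverse of a; it is unique by cinvP. *)
Definition cinv (a : L) : conj_plane := (ip G a a)^-1 *: (a : 'rV[R]_2).

Definition tdiv n (t : tpow L n.+1) (a : L) : tpow L n := contr t (cinv a).

Lemma cinvP (a : L) : a != 0 ->
  hform a (cinv a) = 1 /\ forall u : conj_plane, hform a u = 1 -> u = cinv a.
Proof.
move=> a0; have aa : ip G a a != 0 by rewrite gt_eqF // ip_gt0.
split=> [|u au1].
  have ci j : (cinv a : 'rV_2) 0 j = (ip G a a)^-1 * a 0 j by rewrite mxE.
  rewrite /hform !ip_rot !ci ipE !ci; set r := (ip G a a)^-1.
  have ra : r * ip G a a = 1 by rewrite mulVf.
  rewrite (_ : Num.sqrt _ * _ = 0); last by ring.
  rewrite [X in X +i* _](_ : _ = r * ip G a a); last by rewrite ipE; ring.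
  by rewrite ra.
have ha : (a : 'rV[R]_2) = ip G a a *: (u : 'rV[R]_2).
  by rewrite -[RHS](hform_scale a u) hformC au1 rmorph1 scale1r.
have: (ip G a a)^-1 *: (a : 'rV[R]_2) = u.
  by rewrite {3}ha scalerA mulVf // scale1r.
by move=> <-.
Qed.

(* The coordinate of t in the basis e^n, for a unit vector e. *)
Fixpoint tcoef (e : L) n : tpow L n -> C :=
  if n is m.+1 then fun t : tpow L m.+1 => tcoef e (t (hcov e) : tpow L m)
  else fun c => c.

Lemma tcoefK (e : L) n (t : tpow L n) : ip G e e = 1 ->
  t = tcoef e t *: texp n e.
Proof.
move=> e1; elim: n t => [|n IHn] t; first by rewrite /= [RHS]mulr1.
apply/lfunP => f; rewrite scale_lfunE lfunE /= /tpure_fun.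
have {1}-> : f = (f e : C) *: hcov e.
  apply/lfunP => u; rewrite scale_lfunE lfunE /= -{1}(hformK u e1) linearZ.
  exact: mulrC.
by rewrite linearZ /= {1}[t (hcov e)]IHn !scalerA mulrC.
Qed.

(* The Hermitian norm on L^n with |a b| = |a| |b|: it does not depend on the
   unit vector (tnormE), and tnormZ and tnorm_texp characterize it. *)
Definition tnorm n (t : tpow L n) : R := normc (tcoef (unit0 G) t).

Lemma tcoefZ (e : L) n c (t : tpow L n) : tcoef e (c *: t) = c * tcoef e t.
Proof.
by elim: n t => [//|n IHn] t /=; rewrite scale_lfunE IHn.
Qed.
Lemma tcoef_texp (e : L) n (z : L) : tcoef e (texp n z) = hform z e ^+ n.
Proof.
elim: n => [//|n IHn] /=.
by rewrite lfunE /= /tpure_fun tcoefZ IHn exprS lfunE.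
Qed.

Lemma normc_hform (u v : L) :
  normc (hform u v) = Num.sqrt (ip G u u * ip G v v).
Proof.
rewrite /normc /hform ip_rot; congr (Num.sqrt _).
by rewrite exprMn gram_sqrt_sqr !ipE; ring.
Qed.

Lemma tnorm_texp n (z : L) : tnorm (texp n z) = Num.sqrt (ip G z z) ^+ n.
Proof.
rewrite /tnorm tcoef_texp; elim: n => [|n IHn]; first by rewrite !expr0 normc1.
by rewrite !exprS normcM IHn normc_hform unit0P mulr1.
Qed.

Lemma tnormZ n c (t : tpow L n) : tnorm (c *: t) = normc c * tnorm t.
Proof. by rewrite /tnorm tcoefZ normcM. Qed.

Lemma tnormE (e : L) n (t : tpow L n) : ip G e e = 1 ->
  tnorm t = normc (tcoef e t).
Proof.
move=> e1; rewrite {1}(tcoefK t e1) tnormZ tnorm_texp e1 sqrtr1 expr1n.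
by rewrite mulr1.
Qed.

(* Traceless endomorphisms that are symmetric for the metric. *)
Definition S20 : set 'M[R]_2 :=
  [set A | \tr A = 0 /\
           forall u v : 'rV[R]_2, ip G (u *m A) v = ip G u (v *m A)].

Definition flat (z : 'rV[R]_2) : 'cV[R]_2 := G *m z^T.

(* Induced norm on covectors, for which flat is an isometry. *)
Definition conorm (xi : 'cV[R]_2) : R :=
  Num.sqrt ((xi^T *m invmx G *m xi) 0 0).

Lemma conorm_flat z : conorm (flat z) = Num.sqrt (ip G z z).
Proof.
rewrite /conorm /flat trmx_mul trmxK gram_sym -!mulmxA.
rewrite (mulmxA (invmx G)) mulVmx ?mul1mx ?mulmxA //.
by rewrite unitmxE unitfE gt_eqF ?gram_det_gt0.
Qed.

(* The matrix M describes the endomorphism e_j |-> sum_i M i j *: e_i, where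
   e_1, e_2 are the rows of B; it does not depend on e by Phi_at_indep. *)
Definition Phi_at (e : L) (v : L) (w : tpow L 3) (xi : 'cV[R]_2) : 'M[R]_2 :=
  let B : 'M[R]_2 := \matrix_(i < 2) (if i == 0 then e : 'rV[R]_2
                                      else (e : 'rV[R]_2) *m rot G) in
  let: a +i* b := hform v e in
  let: alpha +i* beta := tcoef e w in
  let p1 := (Num.sqrt 2)^-1 * (a - alpha) in
  let q1 := (Num.sqrt 2)^-1 * (b - beta) in
  let p2 := (Num.sqrt 2)^-1 * (- b - beta) in
  let q2 := (Num.sqrt 2)^-1 * (a + alpha) in
  let xi1 := (row 0 B *m xi) 0 0 in
  let xi2 := (row 1 B *m xi) 0 0 in
  let M := xi1 *: mx2 p1 q1 q1 (- p1) + xi2 *: mx2 p2 q2 q2 (- p2) in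
  invmx B *m M^T *m B.

Definition Phi := Phi_at (unit0 G).

Lemma Phi_at_indep (e e' v : L) w xi : ip G e e = 1 -> ip G e' e' = 1 ->
  Phi_at e v w xi = Phi_at e' v w xi.
Proof.
move=> e1 e1'.
have := tcoefK w e1; set gam := tcoef e w => wE.
have tw : tcoef e' w = gam * hform e e' ^+ 3 by rewrite wE tcoefZ tcoef_texp.
have vE := hformK v e1.
have hv : hform v e' = hform v e * hform e e'.
  by rewrite -{1}vE -[LHS]/(hcov_fun e' _) linearZ.
have eE := hformK e e1'.
rewrite /Phi_at.
set B := \matrix_(i < 2) (if i == 0 then (e : 'rV_2) else _).
set B' := \matrix_(i < 2) (if i == 0 then (e' : 'rV_2) else _).
case cE : (hform e e') => [x y].
rewrite hv tw cE -/gam; case: (hform v e) => a b; case: gam {wE tw} => al be.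
have xy : x ^+ 2 + y ^+ 2 = 1.
  have := normc_hform e e'; rewrite cE e1 e1' mulr1 sqrtr1 /= => h.
  by rewrite -[LHS]sqr_sqrtr ?addr_ge0 ?sqr_ge0 // h expr1n.
have eE0 : (e : 'rV[R]_2) = x *: (e' : 'rV_2) + y *: ((e' : 'rV_2) *m rot G).
  by rewrite -[LHS]eE cE.
pose Q := mx2 x y (- y) x.
have BE : B = Q *m B'.
  apply/matrixP => i j; rewrite !mxE sum2 !mxE /=; move: i; apply: ord2P => /=.
    by rewrite {1}eE0 !mxE.
  rewrite {1}eE0 mulmxDl -!scalemxAl rot_sqr !mxE; ring.
have QQ : Q^T *m Q = 1%:M.
  apply/matrixP; apply: ord2P; apply: ord2P; rewrite !mxE sum2 !mxE /=;
    by rewrite -?xy; ring.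
have [QQ' Qu] := (mulmx1C QQ, mulmx1_unit QQ).
have B'u : B' \in unitmx.
  rewrite unitmxE unitfE det2 ![B' _ _]mxE /= gt_eqF //; apply: rot_oriented.
  by apply/eqP => e0; move: e1'; rewrite e0 /ip !mul0mx mxE
    => /eqP; rewrite eq_sym oner_eq0.
have iB : invmx B = invmx B' *m Q^T.
  have BB : B *m (invmx B' *m Q^T) = 1%:M.
    by rewrite BE -mulmxA (mulmxA B') mulmxV // mul1mx.
  have [Bu _] := mulmx1_unit BB.
  by apply: (can_inj (mulKmx Bu)); rewrite mulmxV.
have rE (A : 'M[R]_2) i : (row i A *m xi) 0 0 = (A *m xi) i 0.
  by rewrite -row_mul mxE.
have r0 : (row 0 B *m xi) 0 0 = x * (row 0 B' *m xi) 0 0 +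
    y * (row 1 B' *m xi) 0 0.
  by rewrite !rE BE -mulmxA [LHS]mxE sum2 ![Q _ _]mxE.
have r1 : (row 1 B *m xi) 0 0 = - y * (row 0 B' *m xi) 0 0 +
    x * (row 1 B' *m xi) 0 0.
  by rewrite !rE BE -mulmxA [LHS]mxE sum2 ![Q _ _]mxE.
have key (M M' : 'M[R]_2) : Q^T *m M *m Q = M' ->
    invmx B *m M *m B = invmx B' *m M' *m B'.
  by move=> <-; rewrite iB BE !mulmxA.
rewrite !exprS expr0 mulr1; simpc; apply: key.
rewrite r0 r1; set X1 := (row 0 B' *m xi) 0 0; set X2 := (row 1 B' *m xi) 0 0.
set k := (Num.sqrt 2)^-1.
have aE : a = a * (x ^+ 2 + y ^+ 2) by rewrite xy mulr1.
have bE : b = b * (x ^+ 2 + y ^+ 2) by rewrite xy mulr1.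
apply/matrixP; apply: ord2P; apply: ord2P;
  rewrite !mxE !sum2 !mxE /= !sum2 !mxE /= [in RHS]aE [in RHS]bE; ring.
Qed.

End HermitianPowers.

Section Smooth.
Variables (R : realType) (V : normedModType R).

Fixpoint Cn (n : nat) (U : set 'rV[R]_2) (f : 'rV[R]_2 -> V) : Prop :=
  if n is m.+1 then
    (forall p, U p -> differentiable f p) /\ forall d, Cn m U ('D_d f)
  else forall p, U p -> {for p, continuous f}.

(* Infinitely differentiable on the open set U. *)
Definition smooth_on U f := forall n, Cn n U f.

End Smooth.

(* Oriented smooth surfaces, given by an oriented smooth atlas.  The chart
   chart_at x is used to identify the tangent space at x with R^2. *)
Record surface (R : realType) := Surface {
  surf_space :> topologicalType;
  surf_hausdorff : hausdorff_space surf_space;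
  surf_second_countable : @second_countable surf_space;
  chart : Type;
  chart_dom : chart -> set surf_space;
  chart_cod : chart -> set 'rV[R]_2;
  chart_fun : chart -> surf_space -> 'rV[R]_2;
  chart_inv : chart -> 'rV[R]_2 -> surf_space;
  chart_at : surf_space -> chart;
  chart_dom_open : forall i, open (chart_dom i);
  chart_cod_open : forall i, open (chart_cod i);
  chart_fun_cod : forall i x, chart_dom i x -> chart_cod i (chart_fun i x);
  chart_inv_dom : forall i p, chart_cod i p -> chart_dom i (chart_inv i p);
  chart_funK : forall i x, chart_dom i x -> chart_inv i (chart_fun i x) = x;
  chart_invK : forall i p, chart_cod i p -> chart_fun i (chart_inv i p) = p;
  chart_fun_continuous : forall i x, chart_dom i x ->
    {for x, continuous (chart_fun i)};
  chart_inv_continuous : forall i p, chart_cod i p ->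
    {for p, continuous (chart_inv i)};
  chart_at_dom : forall x, chart_dom (chart_at x) x;
  transition_smooth : forall i j,
    smooth_on [set p | chart_cod i p /\ chart_dom j (chart_inv i p)]
      (chart_fun j \o chart_inv i);
  transition_oriented : forall i j p,
    chart_cod i p -> chart_dom j (chart_inv i p) ->
    0 < \det ('J (chart_fun j \o chart_inv i) p) }.

Section Surface.
Variables (R : realType) (X : surface R).

(* The rows are the coordinate vectors of the chart i at x. *)
Definition frame (i : chart X) (x : X) : 'M[R]_2 :=
  'J (chart_fun (chart_at x) \o chart_inv i) (chart_fun i x).

Record riemannian := Riemannian {
  metric :> X -> inner R;
  metric_smooth : forall i, smooth_on (chart_cod i) (fun p =>
    let x := chart_inv i p in let D := frame i x in D *m metric x *m D^T) }.

Variable g : riemannian.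

Definition tangent (x : X) := cplane (g x).
Definition tangent3 (x : X) := tpow (tangent x) 3.

Definition smooth_tangent (v : forall x, tangent x) := forall i,
  smooth_on (chart_cod i) (fun p =>
    let x := chart_inv i p in (v x : 'rV[R]_2) *m invmx (frame i x)).

(* Smoothness of the complex coefficient of w with respect to the cube of the
   first coordinate vector. *)
Definition smooth_tangent3 (w : forall x, tangent3 x) := forall i,
  exists a b : 'rV[R]_2 -> R^o,
    [/\ smooth_on (chart_cod i) a, smooth_on (chart_cod i) b &
    forall p, chart_cod i p -> let x := chart_inv i p in
      w x = (a p +i* b p) *: texp 3 (row 0 (frame i x) : tangent x)].

(* In the smoothness condition xi is a covector with constant components in the
   chart i, and sigma xi is expressed in that chart. *)
Record traceless_symbol := TracelessSymbol {
  symbol :> forall x : X, {linear 'cV[R]_2 -> 'M[R]_2};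
  symbol_S20 : forall x xi, S20 (g x) (symbol x xi);
  symbol_smooth : forall i (xi : 'cV[R]_2), smooth_on (chart_cod i) (fun p =>
    let x := chart_inv i p in let D := frame i x in
    D *m symbol x (invmx D *m xi) *m invmx D) }.

Definition cotangent := {x : X & 'cV[R]_2}.

Definition singular_set (sigma : traceless_symbol) : set X :=
  [set x | exists2 xi, xi != 0 & sigma x xi = 0].

Definition multiplicity_set (sigma : traceless_symbol) : set cotangent :=
  [set xi | conorm (g (projT1 xi)) (projT2 xi) = 1 /\
            sigma (projT1 xi) (projT2 xi) = 0].

End Surface.

(* Main.v *)
(* In a complex frame f, i f of T_xX with |f|^2 = E, write v = c f, w = d f^3,
   and let y = xi(f) + i xi(i f).  The matrix of Phi(v, w)(xi) is, up to the
   factor 1/sqrt 2, the traceless symmetric matrix with first row (Re z, Im z)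
   for z = c y - E d y^*.  For a unit frame, y = 1 and y = i give c - d and
   i (c + d), whence the existence and uniqueness of v and w at each point; for
   the first coordinate vector f of a chart this expresses c and d smoothly in
   terms of the metric and the symbol.  If E = 1 and xi is the dual of z = h f,
   then y = h and xi is in the kernel iff c h = d h^*, which for |h| = 1 says
   c h^2 = d. *)
Require Import Defs.
From mathcomp Require Import all_boot all_order all_algebra.
From mathcomp Require Import all_classical all_reals all_analysis.
From mathcomp Require Import complex.
From mathcomp Require Import ring lra.

Set Implicit Arguments.
Unset Strict Implicit.
Unset Printing Implicit Defensive.

Import Order.TTheory GRing.Theory Num.Theory.
Import numFieldNormedType.Exports.

Local Open Scope classical_set_scope.
Local Open Scope ring_scope.

(** * Functions of class C^n on an open subset of the plane *)

Section SmoothCalculus.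
Variable R : realType.
Implicit Types (U : set 'rV[R]_2) (n : nat).

Lemma near_eq_differentiable (V W : normedModType R) (f h : V -> W) (p : V) :
  (\near p, f p = h p) -> differentiable f p -> differentiable h p.
Proof.
move=> fh dfp; apply/diffP => /=.
(* The differential of h is selected by [get], so any linear map with the defining property
   suffices; ['d f p] is one, because f and h have the same germ at p. *)
apply: (@getPex _ (fun (dh : {linear V -> W}) => continuous dh /\
  forall y, h y = h (lim (nbhs p)) + dh (y - lim (nbhs p))
                  +o_(y \near p) (y - lim (nbhs p)))).
exists ('d f p); split; first exact: diff_continuous.
apply: eqaddoEx => y; move: y; apply/funeqP; apply/eqaddoP => _/posnumP[e].
have := diffE dfp => /funeqP/eqaddoP/(_ e%:num (gt0 e)).
have lp : lim (nbhs p) = p by rewrite lim_id.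
have fhp := nbhs_singleton fh.
by apply: filterS2 fh => y fhy; rewrite /= !fctE lp fhy fhp.
Qed.

(** Openness turns equality on U into equality near each of its points, hence into equality of
    derivatives. The rules below rely on this: their derivative formulas are known only on U, and
    the induction hypothesis is applied to the formula. *)
Lemma Cn_ext (V : normedModType R) n U (f h : 'rV[R]_2 -> V) : open U ->
  (forall p, U p -> f p = h p) -> Cn n U f -> Cn n U h.
Proof.
move=> oU; elim: n f h => [|n IHn] f h fh.
  move=> Cf p Up; have nfh : \forall q \near p, f q = h q.
    by apply: filterS (open_nbhs_nbhs (conj oU Up)).
  by apply: cvg_trans (near_eq_cvg nfh) _; rewrite -fh //; exact: Cf.
move=> [df Df]; have nfh p : U p -> \forall q \near p, f q = h q.
  by move=> Up; apply: filterS (open_nbhs_nbhs (conj oU Up)).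
split=> [p Up|d].
  exact: near_eq_differentiable (nfh p Up) (df p Up).
by apply: IHn (Df d) => p Up; exact: near_eq_derive (nfh p Up).
Qed.

(** For products, inverses and square roots the derivative again contains the undifferentiated
    function, which is then wanted at one order less. *)
Lemma CnW (V : normedModType R) n U (f : 'rV[R]_2 -> V) :
  Cn n.+1 U f -> Cn n U f.
Proof.
elim: n f => [|n IHn] f [df Df].
  by move=> p Up; exact: differentiable_continuous (df p Up).
by split=> // d; apply: IHn; exact: Df.
Qed.

Lemma Cn_cst (V : normedModType R) n U (v : V) : Cn n U (fun=> v).
Proof.
elim: n v => [|n IHn] v; first by move=> p _; exact: cst_continuous.
split=> [p _|d]; first exact: differentiable_cst.
rewrite (_ : 'D_d _ = fun=> 0) //; apply/funext => p; exact: derive_cst.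
Qed.

Lemma CnD (V : normedModType R) n U (f h : 'rV[R]_2 -> V) : open U ->
  Cn n U f -> Cn n U h -> Cn n U (fun p => f p + h p).
Proof.
move=> oU; elim: n f h => [|n IHn] f h.
  move=> Cf Ch p Up; have := Ch p Up; have := Cf p Up.
  exact: (@cvgD R V _ (nbhs p) _ f h).
move=> [df Df] [dh Dh]; split=> [p Up|d].
  by apply: differentiableD; [exact: df|exact: dh].
apply: Cn_ext (IHn _ _ (Df d) (Dh d)) => // p Up.
by rewrite -deriveD //; apply: diff_derivable; [exact: df|exact: dh].
Qed.

Lemma CnM n U (f h : 'rV[R]_2 -> R^o) : open U ->
  Cn n U f -> Cn n U h -> Cn n U (fun p => f p * h p : R^o).
Proof.
move=> oU; elim: n f h => [|n IHn] f h.
  move=> Cf Ch p Up; have := Ch p Up; have := Cf p Up.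
  exact: (@cvgM R _ (nbhs p) _ f h).
move=> Cf Ch; have [df Df] := Cf; have [dh Dh] := Ch; split=> [p Up|d].
  by apply: differentiableM; [exact: df|exact: dh].
have CD := CnD oU (IHn _ _ (CnW Cf) (Dh d)) (IHn _ _ (CnW Ch) (Df d)).
apply: Cn_ext CD => // p Up.
rewrite [RHS](@deriveM _ _ f h) //; apply: diff_derivable;
  [exact: df|exact: dh].
Qed.

Lemma CnZ (V : normedModType R) n U (f : 'rV[R]_2 -> R^o) (v : V) : open U ->
  Cn n U f -> Cn n U (fun p => f p *: v).
Proof.
move=> oU; elim: n f => [|n IHn] f.
  by move=> Cf p Up; have := Cf p Up; exact: (@cvgZr_tmp R V _ (nbhs p) _ f).
move=> [df Df]; split=> [p Up|d].
  by apply: differentiableZl; exact: df.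
apply: Cn_ext (IHn _ (Df d)) => // p Up.
rewrite (deriveE d (differentiableZl v (df p Up))) deriveE ?diffZl //.
  exact: df.
exact: df.
Qed.

Lemma CnV n U (f : 'rV[R]_2 -> R^o) : open U -> (forall p, U p -> f p != 0) ->
  Cn n U f -> Cn n U (fun p => (f p)^-1 : R^o).
Proof.
move=> oU f0; elim: n => [|n IHn].
  move=> Cf p Up; have := Cf p Up; apply: (@cvgV R _ (nbhs p) _ f).
  exact: f0.
move=> Cf; have [df Df] := Cf; split=> [p Up|d].
  by apply: differentiableV; [exact: df|exact: f0].
have CV := IHn (CnW Cf).
(* The derivative of 1/f is - (1/f) (1/f) f', and 1/f is of class C^n by induction. *)
have CD := CnM oU (@Cn_cst _ n U (-1 : R^o)) (CnM oU (CnM oU CV CV) (Df d)).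
apply: Cn_ext CD => // p Up; rewrite [RHS]deriveV ?f0 //.
  by rewrite mulN1r [RHS]scaleNr expr2 invfM.
exact/diff_derivable/df.
Qed.

Lemma Cn_sqrt n U (f : 'rV[R]_2 -> R^o) : open U ->
  (forall p, U p -> 0 < f p) ->
  Cn n U f -> Cn n U (fun p => Num.sqrt (f p) : R^o).
Proof.
move=> oU f0; elim: n => [|n IHn].
  by move=> Cf p Up; apply: continuous_comp; [exact: Cf|exact: sqrt_continuous].
move=> Cf; have [df Df] := Cf.
have ds p : U p -> differentiable (Num.sqrt : R^o -> R^o) (f p).
  by move=> Up; apply/derivable1_diffP; case: (is_derive1_sqrt (f0 p Up)).
have dsf p (Up : U p) := differentiable_comp (df p Up) (ds p Up).
split=> [p Up|d]; first exact: dsf.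
(* The derivative of the root is f' / (2 sqrt f), where sqrt f is of class C^n by induction and does
   not vanish on U. *)
have CV : Cn n U (fun p => (2 * Num.sqrt (f p))^-1 : R^o).
  apply: CnV => // [p Up|].
    by rewrite mulf_neq0 // gt_eqF // sqrtr_gt0 f0.
  exact: CnM (@Cn_cst _ n U (2 : R^o)) (IHn (CnW Cf)).
apply: Cn_ext (CnM oU (Df d) CV) => // p Up.
rewrite -[RHS]/('D_d ((Num.sqrt : R^o -> R^o) \o f) p).
rewrite (deriveE _ (dsf p Up)) diff_comp //=; [|exact: df|exact: ds].
rewrite diff1E; last exact: ds.
have [_ <-] := is_derive1_sqrt (f0 p Up).
by rewrite derive1E -deriveE //; exact: df.
Qed.

Lemma Cn_coord n m k U (f : 'rV[R]_2 -> 'M[R]_(m.+1, k.+1)) i j : open U ->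
  Cn n U f -> Cn n U (fun p => f p i j : R^o).
Proof.
move=> oU; elim: n f => [|n IHn] f.
  move=> Cf p Up.
  apply: (@continuous_comp _ _ _ f (fun M : 'M[R]_(_, _) => M i j)).
    exact: Cf.
  exact: coord_continuous.
move=> [df Df]; split=> [p Up|d].
  have dij := @differentiable_coord R _ _ (f p) i j.
  exact: (differentiable_comp (df p Up) dij).
apply: Cn_ext (IHn _ (Df d)) => // p Up.
by rewrite derive_mx ?mxE //; exact/diff_derivable/df.
Qed.

End SmoothCalculus.

(** * The isomorphism Phi at a point *)

Section Pointwise.
Local Open Scope complex_scope.
Import ComplexField.Normc.
Variables (R : realType) (G : inner R).
Local Notation C := R[i].
Local Notation L := (cplane G).
Local Notation rot := Defs.rot.
Implicit Types (e f u v z : L) (c d : C).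

Definition frame2 f : 'M[R]_2 :=
  \matrix_(i < 2) (if i == 0 then f : 'rV[R]_2 else (f : 'rV[R]_2) *m rot G).

(** Acting on row vectors x + i y, this is the antilinear map sending u to c u^*; in an orthonormal
    frame the traceless symmetric endomorphisms are exactly these maps. *)
Definition symmx c : 'M[R]_2 :=
  mx2 (complex.Re c) (complex.Im c) (complex.Im c) (- complex.Re c).

Definition ccoord f (xi : 'cV[R]_2) : C :=
  ((f : 'rV[R]_2) *m xi) 0 0 +i* (((f : 'rV[R]_2) *m rot G) *m xi) 0 0.

Lemma cscaleE c u : c *: u =
  complex.Re c *: (u : 'rV[R]_2) + complex.Im c *: ((u : 'rV[R]_2) *m rot G).
Proof. by []. Qed.

Lemma frame2_unit f : f != 0 -> frame2 f \in unitmx.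
Proof.
move=> f0; rewrite unitmxE unitfE det2 ![frame2 f _ _]mxE /= gt_eqF //.
exact: rot_oriented.
Qed.

Lemma unit_neq0 e : ip G e e = 1 -> e != 0.
Proof.
move=> e1; apply/eqP => e0; move: e1; rewrite e0 /ip !mul0mx mxE => /eqP.
by rewrite eq_sym oner_eq0.
Qed.

Lemma symmx_inj : injective symmx.
Proof.
move=> [a b] [a' b'] /matrixP h; have := h 0 0; have := h 0 1.
by rewrite !mxE /= => -> ->.
Qed.

Lemma hformZl c u v : hform (c *: u) v = c * hform u v.
Proof. by rewrite -[LHS]/(hcov_fun v (c *: u)) linearZ. Qed.

(** Up to the factor 1/sqrt 2, the parameters in [Phi_at] satisfy p1 + i q1 = c - d and p2 + i q2 =
    i (c + d), so their combination with real coefficients xi1, xi2 is c y - d y^* for y = xi1 + i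
    xi2. The transpose in [Phi_at] disappears because the matrix is symmetric. *)
Lemma Phi_frame_unit e v w xi : ip G e e = 1 ->
  frame2 e *m Phi v w xi = ((Num.sqrt 2)^-1 *: symmx
    (hform v e * ccoord e xi - tcoef e w * (ccoord e xi)^*)) *m frame2 e.
Proof.
move=> e1; rewrite /Phi (Phi_at_indep v w xi (unit0P G) e1) /Phi_at.
rewrite -/(frame2 e); case: (hform v e) => a b; case: (tcoef e w) => al be.
rewrite !mulmxA mulmxV ?mul1mx ?frame2_unit ?unit_neq0 //.
congr (_ *m _).
have -> : ccoord e xi = (row 0 (frame2 e) *m xi) 0 0
    +i* (row 1 (frame2 e) *m xi) 0 0.
  by rewrite /ccoord !rowK.
move: (_ 0 0) => y1; move: ((row 1 _ *m _) 0 0) => y2; simpc.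
by apply/matrixP; apply: ord2P; apply: ord2P; rewrite !mxE /=; ring.
Qed.

Lemma texpZ n c u : texp n (c *: u) = c ^+ n *: texp n u.
Proof.
have e1 := unit0P G.
by rewrite (tcoefK (texp n (c *: u)) e1) (tcoefK (texp n u) e1) !tcoef_texp
  scalerA hformZl exprMn.
Qed.

Lemma unit_direction f : f != 0 -> exists e, exists2 s : R,
  [/\ ip G e e = 1, 0 < s & s ^+ 2 = ip G f f] & f = s%:C *: e.
Proof.
move=> f0; have E0 := ip_gt0 G f0; set E := ip G f f in E0 *.
pose s := Num.sqrt E; have s0 : 0 < s by rewrite sqrtr_gt0.
have sE : s ^+ 2 = E by rewrite sqr_sqrtr // ltW.
exists (s^-1 *: (f : 'rV[R]_2)), s; last first.
  by rewrite cscaleE /= scale0r addr0 scalerA divff ?scale1r // gt_eqF.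
split=> //; rewrite ipE !mxE.
transitivity (s^-1 ^+ 2 * E); first by rewrite /E ipE; ring.
by rewrite -sE exprVn mulVf // expf_neq0 // gt_eqF.
Qed.

(** Write f = s e with e a unit vector and s > 0. The coordinates of c f and d f^3 with respect to e
    are c s and d s^3, while y scales by s; the surplus s^2 in front of d is the squared norm of f.
    The factor s of the frame occurs on both sides. *)
Lemma Phi_frame f c d xi : f != 0 ->
  frame2 f *m Phi (c *: f) (d *: texp 3 f) xi = ((Num.sqrt 2)^-1 *: symmx
    (c * ccoord f xi - (ip G f f)%:C * d * (ccoord f xi)^*)) *m frame2 f.
Proof.
move=> /unit_direction[e [s [e1 s0 <-] ->]].
have := Phi_frame_unit (c *: (s%:C *: e)) (d *: texp 3 (s%:C *: e)) xi e1.
rewrite !hformZl (hform_unit e1) tcoefZ tcoef_texp hformZl (hform_unit e1).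
have -> : frame2 (s%:C *: e) = s *: frame2 e.
  apply/matrixP => i j; rewrite cscaleE /= scale0r addr0.
  rewrite [LHS]mxE [RHS]mxE [frame2 _ _ _]mxE.
  by case: (i == 0); rewrite -?scalemxAl [LHS]mxE.
have -> : ccoord (s%:C *: e) xi = s%:C * ccoord e xi.
  rewrite cscaleE /ccoord /= scale0r addr0.
  by rewrite -!scalemxAl !mxE; simpc.
move=> PE; rewrite -scalemxAl PE -scalemxAr; congr (_ *: (_ *: symmx _ *m _)).
case: (ccoord e xi) c d {PE} => y1 y2 [c1 c2] [d1 d2].
by rewrite exprS expr2; simpc; congr (_ +i* _); ring.
Qed.

(** For a unit vector e the right-hand side is the complex coordinate of z, so questions about
    covectors become questions about complex numbers. *)
Lemma ccoord_flat e z : ccoord e (flat G z) = hform z e.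
Proof.
rewrite /ccoord /flat !mulmxA -/(ip G _ _) -/(ip G _ _).
by rewrite /hform ![ip G z _]ipC.
Qed.

Lemma flat_comb (a b : R) (u v : 'rV[R]_2) :
  flat G (a *: u + b *: v) = a *: flat G u + b *: flat G v.
Proof. by rewrite /flat linearD !linearZ /= mulmxDr -!scalemxAr. Qed.

Lemma flat_surj (xi : 'cV[R]_2) : exists z : 'rV[R]_2, xi = flat G z.
Proof.
exists (invmx G *m xi)^T; rewrite /flat trmxK mulKVmx // unitmxE unitfE.
by rewrite gt_eqF ?gram_det_gt0.
Qed.

Lemma sqrt2V_neq0 : (Num.sqrt 2 : R)^-1 != 0.
Proof. by rewrite invr_neq0 // gt_eqF // sqrtr_gt0 ltr0n. Qed.

Lemma Phi_flat_eq0 e v w z : ip G e e = 1 ->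
  Phi v w (flat G z) = 0 <->
  hform v e * hform z e = tcoef e w * (hform z e)^*.
Proof.
move=> e1; have := Phi_frame_unit v w (flat G z) e1; rewrite ccoord_flat.
have Bu := frame2_unit (unit_neq0 e1).
have symmx0 : symmx 0 = 0.
  by apply/matrixP; apply: ord2P; apply: ord2P; rewrite !mxE ?oppr0.
move=> PE; split=> [P0|h].
  move: PE; rewrite P0 mulmx0 => /esym/eqP.
  rewrite -(mul0mx _ (frame2 e)) (inj_eq (can_inj (mulmxK Bu))).
  rewrite scaler_eq0 (negPf sqrt2V_neq0) /= -symmx0 => /eqP/symmx_inj/eqP.
  by rewrite subr_eq0 => /eqP.
apply: (can_inj (mulKmx Bu)).
by rewrite PE h subrr symmx0 scaler0 mul0mx mulmx0.
Qed.

Lemma Phi_inj v v' w w' : (forall xi, Phi v w xi = Phi v' w' xi) ->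
  v = v' /\ w = w'.
Proof.
move=> PP; have e1 := unit0P G; set e := unit0 G in e1.
have Bu := frame2_unit (unit_neq0 e1).
have key z : hform v e * hform z e - tcoef e w * (hform z e)^* =
    hform v' e * hform z e - tcoef e w' * (hform z e)^*.
  have := congr1 (mulmx (frame2 e)) (PP (flat G z)).
  rewrite !(Phi_frame_unit _ _ _ e1) ccoord_flat => /(can_inj (mulmxK Bu)).
  by move=> /(scalerI sqrt2V_neq0)/symmx_inj.
(* Taking z = e and z = i e yields c - d and i (c + d), which determine c and d. *)
have := key ((1 +i* 0) *: e); have := key ((0 +i* 1) *: e).
rewrite !hformZl (hform_unit e1) !mulr1.
move=> k1 k2; suff [hv hw] : hform v e = hform v' e /\ tcoef e w = tcoef e w'.
  split; first by rewrite -(hformK v e1) hv hformK.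
  by rewrite (tcoefK w e1) hw -tcoefK.
move: k1 k2.
case: (hform v e) (hform v' e) (tcoef e w) (tcoef e w')
  => a b [a' b'] [al be] [al' be']; simpc => -[h1 h2] [h3 h4].
by split; congr (_ +i* _); lra.
Qed.

(** In the orthonormal frame B the matrix N of A has as entries the inner products of the images of
    the frame vectors with the frame vectors: it is symmetric because A is self-adjoint, and
    traceless because the trace is invariant under conjugation. *)
Lemma S20_symmx e (A : 'M[R]_2) : ip G e e = 1 -> S20 G A ->
  exists c, frame2 e *m A = ((Num.sqrt 2)^-1 *: symmx c) *m frame2 e.
Proof.
move=> e1 [trA symA]; have Bu := frame2_unit (unit_neq0 e1).
set B := frame2 e in Bu *.
(* The Gram matrix of the frame is the identity, so [G *m B^T] is the inverse of B. *)
have BGB : B *m (G *m B^T) = 1%:M.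
  have BG i j : (B *m (G *m B^T)) i j = ip G (row i B) (row j B).
    by rewrite mulmxA mxE /ip mxE; apply: eq_bigr => k _; rewrite -row_mul !mxE.
  apply/matrixP => i j; rewrite BG !rowK mxE.
  move: i j; apply: ord2P; apply: ord2P => /=.
  - by rewrite e1.
  - by rewrite rot_ortho.
  - by rewrite ipC rot_ortho.
  - by rewrite rot_isometry e1.
pose N := B *m A *m (G *m B^T).
have NE i j : N i j = ip G (row i B *m A) (row j B).
  by rewrite /N mulmxA mxE /ip mxE; apply: eq_bigr => k _;
    rewrite -!row_mul !mxE.
have N10 : N 1 0 = N 0 1 by rewrite !NE symA ipC.
have N11 : N 1 1 = - N 0 0.
  apply/eqP; rewrite -addr_eq0 addrC -(sum2 (fun i => N i i)).
  rewrite -[X in X == 0]/(\tr N).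
  by rewrite /N mxtrace_mulC mulmxA (mulmx1C BGB) mul1mx trA.
have GB : B *m A = N *m B by rewrite /N -mulmxA (mulmx1C BGB) mulmx1.
exists ((Num.sqrt 2 * N 0 0) +i* (Num.sqrt 2 * N 0 1)); rewrite GB.
congr (_ *m _); have s2 := sqrt2V_neq0; rewrite invr_eq0 in s2.
apply/matrixP; apply: ord2P; apply: ord2P; rewrite ?N10 ?N11 !mxE /=.
- by rewrite mulKf.
- by rewrite mulKf.
- by rewrite mulKf.
- by rewrite mulrN mulKf.
Qed.

Lemma Phi_surj (s : {linear 'cV[R]_2 -> 'M[R]_2}) :
  (forall xi, S20 G (s xi)) ->
  exists v w, forall xi, s xi = Phi v w xi.
Proof.
move=> sS; have e1 := unit0P G; set e := unit0 G in e1.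
have Bu := frame2_unit (unit_neq0 e1).
have zeta xi : exists c, frame2 e *m s xi =
    ((Num.sqrt 2)^-1 *: symmx c) *m frame2 e.
  exact: S20_symmx (sS xi).
have [[a1 b1] z1] := zeta (flat G e).
have [[a2 b2] z2] := zeta (flat G ((e : 'rV[R]_2) *m rot G)).
(* These coefficients solve c - d = a1 + i b1 and i (c + d) = a2 + i b2, the values prescribed at
   the duals of e and i e; linearity in xi does the rest. *)
exists (((a1 + b2) / 2 +i* ((b1 - a2) / 2)) *: e).
exists (((b2 - a1) / 2 +i* (- (b1 + a2) / 2)) *: texp 3 e) => xi.
apply: (can_inj (mulKmx Bu)).
rewrite (Phi_frame_unit _ _ _ e1) tcoefZ tcoef_texp hformZl (hform_unit e1).
rewrite expr1n !mulr1.
have [z ->] := flat_surj xi; rewrite ccoord_flat.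
have zE : (z : 'rV[R]_2) = complex.Re (hform z e) *: (e : 'rV[R]_2) +
    complex.Im (hform z e) *: ((e : 'rV[R]_2) *m rot G).
  by rewrite -[LHS](hformK z e1).
rewrite [in LHS]zE; move: (_ *m rot G) z2 {zE} => ie z2.
case: (hform z e) => x y /=.
rewrite flat_comb linearD !linearZ mulmxDr -!scalemxAr z1 z2 !scalemxAl.
rewrite -mulmxDl.
congr (_ *m _); simpc.
by apply/matrixP; apply: ord2P; apply: ord2P; rewrite !mxE /=; field.
Qed.

(** Division contracts one factor e of e^3 with the inverse of a. Since a = c e pairs to 1 with its
    inverse, e pairs to 1/c. *)
Lemma tdivE e c d (a : L) : ip G e e = 1 -> a = c *: e -> a != 0 ->
  tdiv (d *: texp 3 e) a = (d / c) *: texp 2 e.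
Proof.
move=> e1 aE a0; have [h _] := cinvP a0.
rewrite /tdiv /contr scale_lfunE /= lfunE /= /tpure_fun scalerA.
rewrite /hcov lfunE /= /hcov_fun.
move: h; rewrite {1}aE hformZl => h; congr (_ *: _); congr (_ * _).
rewrite -[RHS]mulr1 -h mulKf //; apply/eqP => c0; move: h.
by rewrite c0 mul0r => /eqP; rewrite eq_sym oner_eq0.
Qed.

End Pointwise.

(** * The kernel of Phi(v, w) and the square roots of w/v *)

Section Kernel.
Local Open Scope complex_scope.
Import ComplexField.Normc.
Variables (R : realType) (G : inner R).
Local Notation C := R[i].
Local Notation L := (cplane G).
Local Notation e := (unit0 G).
Implicit Types (u v z : L) (w : tpow L 3).

Lemma mulc_conj (h : C) : h * h^* = (normc h ^+ 2)%:C.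
Proof.
case: h => a b; rewrite /= sqr_sqrtr ?addr_ge0 ?sqr_ge0 //.
by simpc; congr (_ +i* _); ring.
Qed.

Lemma normc_conj (h : C) : normc (h^*)%R = normc h.
Proof. by case: h => a b; rewrite /= sqrrN. Qed.

Lemma unit_conj (h : C) : normc h = 1 -> h * h^* = 1.
Proof. by move=> h1; rewrite mulc_conj h1 expr1n. Qed.

(** Norms give |c| |h|^2 = |c|. Hence the solutions of z^2 = w/v are automatically unit vectors when
    |w/v| = 1. *)
Lemma normc_sqrt_ratio (c d h : C) : c != 0 -> normc d = normc c ->
  c * h ^+ 2 = d -> normc h = 1.
Proof.
move=> c0 dc hE; have n0 : normc c != 0 by apply: contra_neq c0 => /eq0_normc.
have h0 : 0 <= normc h by case: h hE => a b _; exact: sqrtr_ge0.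
have : normc c * normc h ^+ 2 = normc c by rewrite -[RHS]dc -hE !normcM.
rewrite -[RHS]mulr1 => /(mulfI n0)/eqP.
by rewrite -[X in _ == X](expr1n _ 2) eqrXn2 // => /eqP.
Qed.

Lemma normc_hform_unit0 z : normc (hform z e) = Num.sqrt (ip G z z).
Proof. by rewrite normc_hform unit0P mulr1. Qed.

Lemma hform0l u : hform (0 : L) u = 0.
Proof. by rewrite -(scale0r (0 : L)) hformZl mul0r. Qed.

Lemma tcoef0 n : tcoef e (0 : tpow L n) = 0.
Proof. by rewrite -(scale0r (0 : tpow L n)) tcoefZ mul0r. Qed.

Lemma hform_unit0_eq0 z : (hform z e == 0) = (z == 0).
Proof.
apply/eqP/eqP => [h|->]; last exact: hform0l.
by rewrite -(hformK z (unit0P G)) h scale0r.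
Qed.

Lemma tcoef_eq0 n (t : tpow L n) : (tcoef e t == 0) = (t == 0).
Proof.
apply/eqP/eqP => [h|->]; last exact: tcoef0.
by rewrite (tcoefK t (unit0P G)) h scale0r.
Qed.

Lemma tcoef_tdiv w v : v != 0 -> tcoef e (tdiv w v) = tcoef e w / hform v e.
Proof.
move=> v0; rewrite {1}(tcoefK w (unit0P G)).
rewrite (tdivE _ (unit0P G) (esym (hformK v (unit0P G)))) //.
by rewrite tcoefZ tcoef_texp hform_unit ?unit0P // expr1n mulr1.
Qed.

Lemma texp2_tdiv w v z : v != 0 ->
  texp 2 z = tdiv w v <-> hform v e * hform z e ^+ 2 = tcoef e w.
Proof.
move=> v0; have c0 : hform v e != 0 by rewrite hform_unit0_eq0.
split=> [zE|zE].
  by rewrite -tcoef_texp zE tcoef_tdiv // mulrC divfK.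
rewrite (tcoefK (texp 2 z) (unit0P G)) (tcoefK (tdiv w v) (unit0P G)).
by rewrite tcoef_tdiv // tcoef_texp -zE mulrC mulKf.
Qed.

Lemma tnorm_tdiv_eq1 w v : v != 0 ->
  tnorm (tdiv w v) = 1 <-> normc (tcoef e w) = normc (hform v e).
Proof.
move=> v0; have c0 : hform v e != 0 by rewrite hform_unit0_eq0.
have n0 : normc (hform v e) != 0.
  by apply: contra_neq c0 => /eq0_normc.
rewrite /tnorm tcoef_tdiv // normcM normcV; split=> [h|->]; last exact: mulfV.
by rewrite -[LHS](divfK n0) h mul1r.
Qed.

(** A nonzero solution h of c h = d h^* forces |c| = |d|; conversely, for |c| = |d| nonzero, a
    square root of d/c is a solution. The second alternative covers the points where the quotient is
    undefined: there the whole map vanishes. *)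
Lemma Phi_kernel v w :
  (exists2 xi, xi != 0 & Phi v w xi = 0) <->
  (v != 0 /\ tnorm (tdiv w v) = 1) \/ (v = 0 /\ w = 0).
Proof.
have e1 := unit0P G; split.
  move=> [xi]; have [z ->] := flat_surj G xi => z0 /(Phi_flat_eq0 _ _ _ e1) zE.
  have h0 : hform z e != 0.
    rewrite hform_unit0_eq0; apply: contra_neq z0 => ->.
    by rewrite /flat trmx0 mulmx0.
  (* If v = 0, the equation reads d h^* = 0 and forces w = 0. *)
  have [v0|v0] := eqVneq v 0.
    right; split=> //; apply/eqP; rewrite -tcoef_eq0.
    move/esym/eqP: zE; rewrite v0 hform0l.
    by rewrite mul0r mulf_eq0 conjc_eq0 (negPf h0) orbF.
  left; split=> //; apply/(tnorm_tdiv_eq1 _ v0).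
  have n0 : normc (hform z e) != 0.
    by apply: contra_neq h0 => /eq0_normc.
  by apply: (mulIf n0); rewrite -[in LHS](normc_conj (hform z e)) -!normcM zE.
case=> [[v0 /(tnorm_tdiv_eq1 _ v0) n1]|[-> ->]]; last first.
  exists (flat G e).
    apply/eqP => f0; have := hform_unit e1; rewrite -ccoord_flat f0.
    by rewrite /ccoord !mulmx0 !mxE => /eqP; rewrite eq_sym oner_eq0.
  apply/(Phi_flat_eq0 _ _ _ e1).
  by rewrite hform0l tcoef0 !mul0r.
have c0 : hform v e != 0 by rewrite hform_unit0_eq0.
(* This square root has norm 1, and h h^* = 1 turns c h^2 = d into the kernel equation c h = d
   h^*. *)
pose h := sqrtc (tcoef e w / hform v e).
have hE : hform v e * h ^+ 2 = tcoef e w by rewrite sqr_sqrtc mulrC divfK.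
have h1 := normc_sqrt_ratio c0 n1 hE.
exists (flat G (h *: e)).
  apply/eqP => f0; have : hform (h *: e) e = 0.
    by rewrite -ccoord_flat f0 /ccoord !mulmx0 !mxE.
  rewrite hformZl (hform_unit e1) mulr1 => h0; move: h1; rewrite h0 normc0.
  by move/eqP; rewrite eq_sym oner_eq0.
apply/(Phi_flat_eq0 _ _ _ e1); rewrite hformZl (hform_unit e1) mulr1.
by rewrite -hE -mulrA expr2 -(mulrA h) unit_conj // mulr1.
Qed.

(** For |h| = 1, multiplying c h = d h^* by h gives c h^2 = d, and multiplying by h^* leads back. If
    v = w = 0, every unit covector is in the kernel. *)
Lemma Phi_unit_kernel v w xi :
  conorm G xi = 1 /\ Phi v w xi = 0 <->
  (exists z, [/\ v != 0, tnorm (tdiv w v) = 1, texp 2 z = tdiv w v &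
     flat G z = xi]) \/ [/\ v = 0, w = 0 & conorm G xi = 1].
Proof.
have e1 := unit0P G.
have ker0 : Phi (0 : L) (0 : tpow L 3) xi = 0.
  have [z ->] := flat_surj G xi; apply/(Phi_flat_eq0 _ _ _ e1).
  by rewrite hform0l tcoef0 !mul0r.
split=> [[n1 P0]|].
  have : exists2 xi, xi != 0 & Phi v w xi = 0.
    exists xi => //; apply: contra_eq_neq n1 => ->.
    by rewrite /conorm mulmx0 mxE sqrtr0 eq_sym oner_eq0.
  move=> /Phi_kernel[[v0 t1]|[-> ->]]; last by right.
  left; have [z zE] := flat_surj G xi; exists z; split=> //.
  apply/texp2_tdiv => //.
  move: n1 P0; rewrite zE conorm_flat -normc_hform_unit0 => n1.
  move=> /(Phi_flat_eq0 _ _ _ e1) h.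
  by rewrite expr2 mulrA h -mulrA [_^* * _]mulrC unit_conj // mulr1.
case=> [[z [v0 t1 /(texp2_tdiv _ _ v0) zE <-]]|[-> -> n1]]; last by [].
have n1 : normc (hform z e) = 1.
  apply: normc_sqrt_ratio zE; rewrite ?hform_unit0_eq0 //.
  exact/(tnorm_tdiv_eq1 _ v0).
rewrite conorm_flat -normc_hform_unit0 n1; split=> //.
apply/(Phi_flat_eq0 _ _ _ e1).
by rewrite -zE -mulrA expr2 -[_ * _ * _^*]mulrA unit_conj // mulr1.
Qed.

End Kernel.

(** * Coefficients in a chart *)

Section ChartCoefficients.
Local Open Scope complex_scope.
Import ComplexField.Normc.
Variable R : realType.
Local Notation C := R[i].
Implicit Types (H S : 'M[R]_2).

(** The area density of the chart; the determinant is expanded so that its smoothness is read off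
    from the entries of H. *)
Definition gsqrt H : R := Num.sqrt (H 0 0 * H 1 1 - H 0 1 * H 1 0).

(* The rows are f and i f in the coordinate basis, f being its first vector. *)
Definition chart_frame2 H : 'M[R]_2 :=
  mx2 1 0 (- H 0 1 / gsqrt H) (H 0 0 / gsqrt H).

(* H is the Gram matrix of the coordinate vectors of a chart and S0, S1 are the
   matrices of the symbol at dx, dy.  Solving the equations of chart_coefE for c
   and d yields c + E d = sum_re + i sum_im and c - E d = diff_re + i diff_im,
   where E = H 0 0. *)
Definition sum_re H S1 : R := Num.sqrt 2 * S1 0 1 * gsqrt H ^+ 2 / H 0 0 ^+ 2.

Definition sum_im H S1 : R :=
  - (Num.sqrt 2 * (S1 0 0 + S1 0 1 * (H 0 1 / H 0 0)) * (gsqrt H / H 0 0)).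

Definition diff_re H S0 S1 : R :=
  Num.sqrt 2 * (S0 0 0 + S0 0 1 * (H 0 1 / H 0 0))
  - H 0 1 / gsqrt H * sum_im H S1.

Definition diff_im H S0 S1 : R :=
  Num.sqrt 2 * S0 0 1 * (gsqrt H / H 0 0) + H 0 1 / gsqrt H * sum_re H S1.

Definition v_re H S0 S1 : R := (sum_re H S1 + diff_re H S0 S1) / 2.
Definition v_im H S0 S1 : R := (sum_im H S1 + diff_im H S0 S1) / 2.
Definition w_re H S0 S1 : R := (sum_re H S1 - diff_re H S0 S1) / 2 / H 0 0.
Definition w_im H S0 S1 : R := (sum_im H S1 - diff_im H S0 S1) / 2 / H 0 0.

(** The first row of [chart_frame2 H] is (1, 0), so the first rows of the two matrix equations
    express the first rows of S 0 and S 1 through c and d. Substituting these four entries into the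
    formulas leaves rational identities. *)
Lemma chart_coefE H (S : 'I_2 -> 'M[R]_2) (c d : C) :
  0 < H 0 0 -> 0 < gsqrt H ->
  (forall k, let y := chart_frame2 H 0 k +i* chart_frame2 H 1 k in
     chart_frame2 H *m S k = ((Num.sqrt 2)^-1 *: symmx
       (c * y - (H 0 0)%:C * d * y^*)) *m chart_frame2 H) ->
  c = v_re H (S 0) (S 1) +i* v_im H (S 0) (S 1) /\
  d = w_re H (S 0) (S 1) +i* w_im H (S 0) (S 1).
Proof.
move=> E0 t0 hS; have := hS 1; have := hS 0.
rewrite /v_re /v_im /w_re /w_im /diff_re /diff_im /sum_re /sum_im.
move: (S 0) (S 1) => S0 S1 {hS}.
case: c d => c1 c2 [d1 d2] /matrixP h0 /matrixP h1.
have := h0 0 0; have := h0 0 1; have := h1 0 0; have := h1 0 1.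
rewrite !mxE !sum2 !mxE /= => {h0 h1}.
have s2 : Num.sqrt 2 != 0 :> R by rewrite gt_eqF // sqrtr_gt0 ltr0n.
move: (gsqrt H) (H 0 0) (H 0 1) t0 E0 => t E F /lt0r_neq0 t0 /lt0r_neq0 E0.
rewrite !mul1r !mul0r !addr0 !mulr1 !mulr0 ?add0r => -> -> -> ->.
by split; congr (_ +i* _); field; rewrite ?s2 ?t0 ?E0.
Qed.

Lemma frame2_row0 (G : inner R) (D : 'M[R]_2) : 0 < \det D ->
  let H := D *m G *m D^T in
  [/\ 0 < H 0 0, 0 < gsqrt H, ip G (row 0 D) (row 0 D) = H 0 0 &
      frame2 (row 0 D : cplane G) = chart_frame2 H *m D].
Proof.
move=> D0 H; have dG := gram_det_gt0 G.
have HE i j : H i j = ip G (row i D) (row j D).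
  by rewrite /H /ip -!row_mul !mxE; apply: eq_bigr => k _; rewrite !mxE.
(* As det H = (det D)^2 det G, the sign of det D matters here: a positively oriented chart makes the
   second row i f and not - i f. *)
have tE : gsqrt H = \det D * Num.sqrt (\det (G : 'M[R]_2)).
  rewrite /gsqrt -det2 /H !det_mulmx det_tr mulrAC -expr2 sqrtrM ?sqr_ge0 //.
  by rewrite sqrtr_sqr gtr0_norm.
have s0 : 0 < Num.sqrt (\det (G : 'M[R]_2)) by rewrite sqrtr_gt0.
have t0 : 0 < gsqrt H by rewrite tE mulr_gt0.
have D0' : D 0 0 * D 1 1 - D 0 1 * D 1 0 != 0 by rewrite -det2 gt_eqF.
split=> //.
  rewrite HE; apply: ip_gt0; apply/eqP => /rowP r0; move: D0'.
  have := r0 0; have := r0 1; rewrite !mxE => -> ->.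
  by rewrite !mul0r subr0 eqxx.
apply/matrixP => i j; rewrite [RHS]mxE sum2 ![chart_frame2 _ _ _]mxE.
rewrite [LHS]mxE; move: i; apply: ord2P => /=.
  by rewrite mul1r mul0r addr0 mxE.
rewrite !HE tE det2; move: j; apply: ord2P; rewrite (rotE0, rotE1) !ipE !mxE;
  by field; rewrite gt_eqF // D0'.
Qed.

Lemma CnN n (U : set 'rV[R]_2) (f : 'rV[R]_2 -> R^o) : open U ->
  Cn n U f -> Cn n U (fun p => - f p : R^o).
Proof.
move=> oU Cf; apply: Cn_ext (CnM oU (@Cn_cst _ _ n U (-1 : R^o)) Cf) => // p _.
exact: mulN1r.
Qed.

(** * Smoothness of the chart formulas *)

Section Smoothness.
Variables (n : nat) (U : set 'rV[R]_2) (H S0 S1 : 'rV[R]_2 -> 'M[R]_2).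
Hypotheses (oU : open U) (E0 : forall p, U p -> 0 < H p 0 0)
  (t0 : forall p, U p -> 0 < gsqrt (H p)).
Hypotheses (CH : Cn n U H) (CS0 : Cn n U S0) (CS1 : Cn n U S1).

Lemma Cn_gsqrt : Cn n U (fun p => gsqrt (H p) : R^o).
Proof.
apply: Cn_sqrt => // [p /t0|]; first by rewrite sqrtr_gt0.
by apply: CnD => //; [|apply: CnN => //]; apply: CnM => //; exact: Cn_coord.
Qed.

Lemma Cn_div (f h : 'rV[R]_2 -> R^o) : (forall p, U p -> 0 < h p) ->
  Cn n U f -> Cn n U h -> Cn n U (fun p => f p / h p : R^o).
Proof.
move=> h0 Cf Ch; apply: CnM => //; apply: CnV => // p /h0.
exact: lt0r_neq0.
Qed.

Let CE : Cn n U (fun p => H p 0 0 : R^o). Proof. exact: Cn_coord. Qed.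
Let CF : Cn n U (fun p => H p 0 1 : R^o). Proof. exact: Cn_coord. Qed.

Lemma Cn_slope : Cn n U (fun p => H p 0 1 / gsqrt (H p) : R^o).
Proof. exact: Cn_div Cn_gsqrt. Qed.

Lemma Cn_symbol_re (S : 'rV[R]_2 -> 'M[R]_2) : Cn n U S ->
  Cn n U (fun p =>
    Num.sqrt 2 * (S p 0 0 + S p 0 1 * (H p 0 1 / H p 0 0)) : R^o).
Proof.
move=> CS; apply: CnM => //; first exact: Cn_cst.
apply: CnD => //; first exact: Cn_coord.
by apply: CnM => //; [exact: Cn_coord|exact: Cn_div].
Qed.

Lemma Cn_sum_re : Cn n U (fun p => sum_re (H p) (S1 p) : R^o).
Proof.
apply: (@Cn_div (fun p => Num.sqrt 2 * S1 p 0 1 * gsqrt (H p) ^+ 2)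
  (fun p => H p 0 0 ^+ 2)) => [p /E0| |].
- by move=> ?; rewrite exprn_gt0.
- apply: CnM => //; last by apply: CnM => //; exact: Cn_gsqrt.
  by apply: CnM => //; [exact: Cn_cst|exact: Cn_coord].
- exact: CnM.
Qed.

Lemma Cn_sum_im : Cn n U (fun p => sum_im (H p) (S1 p) : R^o).
Proof.
apply: CnN => //; apply: CnM => //; first exact: Cn_symbol_re.
exact: Cn_div Cn_gsqrt CE.
Qed.

Lemma Cn_diff_re : Cn n U (fun p => diff_re (H p) (S0 p) (S1 p) : R^o).
Proof.
apply: CnD => //; first exact: Cn_symbol_re.
by apply: CnN => //; apply: CnM => //; [exact: Cn_slope|exact: Cn_sum_im].
Qed.

Lemma Cn_diff_im : Cn n U (fun p => diff_im (H p) (S0 p) (S1 p) : R^o).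
Proof.
apply: CnD => //.
  apply: CnM => //; last exact: Cn_div Cn_gsqrt CE.
  by apply: CnM => //; [exact: Cn_cst|exact: Cn_coord].
by apply: CnM => //; [exact: Cn_slope|exact: Cn_sum_re].
Qed.

Lemma Cn_v_re : Cn n U (fun p => v_re (H p) (S0 p) (S1 p) : R^o).
Proof.
apply: CnM => //; last exact: Cn_cst.
by apply: CnD => //; [exact: Cn_sum_re|exact: Cn_diff_re].
Qed.

Lemma Cn_v_im : Cn n U (fun p => v_im (H p) (S0 p) (S1 p) : R^o).
Proof.
apply: CnM => //; last exact: Cn_cst.
by apply: CnD => //; [exact: Cn_sum_im|exact: Cn_diff_im].
Qed.

Lemma Cn_w_re : Cn n U (fun p => w_re (H p) (S0 p) (S1 p) : R^o).
Proof.
apply: Cn_div => //; apply: CnM => //; last exact: Cn_cst.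
by apply: CnD => //; [exact: Cn_sum_re|apply: CnN => //; exact: Cn_diff_re].
Qed.

Lemma Cn_w_im : Cn n U (fun p => w_im (H p) (S0 p) (S1 p) : R^o).
Proof.
apply: Cn_div => //; apply: CnM => //; last exact: Cn_cst.
by apply: CnD => //; [exact: Cn_sum_im|apply: CnN => //; exact: Cn_diff_im].
Qed.

Lemma Cn_v_row : Cn n U (fun p =>
  v_re (H p) (S0 p) (S1 p) *: row 0 (chart_frame2 (H p))
  + v_im (H p) (S0 p) (S1 p) *: row 1 (chart_frame2 (H p))).
Proof.
(* The row is split along the constant standard basis, with E = H 0 0, F = H 0 1 and t the area
   density: its coordinates are v_re - v_im F/t and v_im E/t. *)
have CC := CnD oU (CnZ (delta_mx 0 0 : 'rV[R]_2) oU
    (CnD oU Cn_v_re (CnN oU (CnM oU Cn_v_im Cn_slope))))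
  (CnZ (delta_mx 0 1 : 'rV[R]_2) oU (CnM oU Cn_v_im (Cn_div t0 CE Cn_gsqrt))).
apply: Cn_ext CC => // p _; apply/rowP; apply: ord2P; rewrite !mxE /=; ring.
Qed.

End Smoothness.

Lemma frame_coord_exists (G : inner R) (f v : cplane G)
    (w : tpow (cplane G) 3) :
  f != 0 -> exists c d, v = c *: f /\ w = d *: texp 3 f.
Proof.
move=> /unit_direction[e [s [e1 s0 _] ->]].
have sC : s%:C != 0 :> C by rewrite -[0]/(0%:C) (inj_eq (@complexI R)) gt_eqF.
exists (hform v e / s%:C), (tcoef e w / s%:C ^+ 3).
rewrite texpZ !scalerA !divfK ?expf_neq0 //.
by rewrite hformK // -tcoefK.
Qed.

(** The chart matrix of s at the k-th coordinate differential, in the form that [symbol_smooth]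
    controls. *)
Definition chart_symbol (D : 'M[R]_2) (s : 'cV[R]_2 -> 'M[R]_2) (k : 'I_2) :=
  D *m s (invmx D *m delta_mx k 0) *m invmx D.

Lemma chart_coefficients (G : inner R) (D : 'M[R]_2)
    (s : 'cV[R]_2 -> 'M[R]_2) (v : cplane G) (w : tpow (cplane G) 3) :
  0 < \det D -> (forall xi, s xi = Phi v w xi) ->
  let H := D *m G *m D^T in
  let S := chart_symbol D s in
  (v : 'rV[R]_2) *m invmx D =
    v_re H (S 0) (S 1) *: row 0 (chart_frame2 H)
    + v_im H (S 0) (S 1) *: row 1 (chart_frame2 H) /\
  w = (w_re H (S 0) (S 1) +i* w_im H (S 0) (S 1)) *:
    texp 3 (row 0 D : cplane G).
Proof.
move=> D0 sE H S; have [E0 t0 EE fE] := frame2_row0 G D0.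
have Du : D \in unitmx by rewrite unitmxE unitfE gt_eqF.
have f0 : (row 0 D : cplane G) != 0.
  by apply/eqP => f0; move: E0; rewrite -EE f0 /ip !mul0mx mxE ltxx.
have [c [d [vE wE]]] := frame_coord_exists v w f0.
(* The k-th coordinate differential takes on f and i f the values in column k of [chart_frame2 H];
   these are the real and imaginary parts of y. *)
have KD k (i : 'I_2) : (row i (frame2 (row 0 D : cplane G)) *m
    (invmx D *m delta_mx k 0 : 'cV_2)) 0 0 = chart_frame2 H i k.
  by rewrite fE mulmxA -!row_mul mulmxK // -colE [LHS]mxE [LHS]mxE.
have [|cE dE] := @chart_coefE H S c d E0 t0.
  move=> k y; rewrite /S /chart_symbol sE vE wE.
  rewrite !mulmxA -fE Phi_frame // EE fE mulmxA mulmxK //.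
  rewrite (_ : ccoord _ _ = y) //.
  by rewrite /y -!KD !rowK.
split; last by rewrite wE dE.
rewrite vE cscaleE cE /=.
have rE i : row i (chart_frame2 H) =
    row i (frame2 (row 0 D : cplane G)) *m invmx D.
  by rewrite fE -row_mul mulmxK.
by rewrite (rE 0) (rE 1) !rowK /= mulmxDl -!scalemxAl.
Qed.

End ChartCoefficients.

(** * Smoothness of the sections v and w *)

Section Charts.
Local Open Scope complex_scope.
Variables (R : realType) (X : surface R).

Lemma frame_det_gt0 (i : chart X) p : chart_cod i p ->
  0 < \det (frame i (chart_inv i p)).
Proof.
move=> ip; rewrite /frame chart_invK //.
exact: transition_oriented ip (chart_at_dom _).
Qed.

Variable g : riemannian X.

(** Any pointwise solution is smooth: in each chart its coefficients are given by quotients and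
    roots of smooth functions built from the metric and the symbol, with nonvanishing
    denominators. *)
Lemma symbol_fields_smooth (sigma : traceless_symbol g)
    (v : forall x, tangent g x) (w : forall x, tangent3 g x) :
  (forall x xi, sigma x xi = Phi (v x) (w x) xi) ->
  smooth_tangent v /\ smooth_tangent3 w.
Proof.
move=> sE.
suff chartP i : exists H S0 S1 : 'rV[R]_2 -> 'M[R]_2,
    [/\ smooth_on (chart_cod i) H, smooth_on (chart_cod i) S0,
        smooth_on (chart_cod i) S1 &
    forall p, chart_cod i p -> let x := chart_inv i p in
      [/\ 0 < H p 0 0, 0 < gsqrt (H p),
      (v x : 'rV[R]_2) *m invmx (frame i x) =
        v_re (H p) (S0 p) (S1 p) *: row 0 (chart_frame2 (H p))
        + v_im (H p) (S0 p) (S1 p) *: row 1 (chart_frame2 (H p)) &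
      w x = (w_re (H p) (S0 p) (S1 p) +i* w_im (H p) (S0 p) (S1 p)) *:
        texp 3 (row 0 (frame i x) : tangent g x)]].
  have oU i := @chart_cod_open R X i.
  split=> i; have [H [S0 [S1 [CH CS0 CS1 P]]]] := chartP i.
    move=> n.
    have E0 p : chart_cod i p -> 0 < H p 0 0 by case/P.
    have t0 p : chart_cod i p -> 0 < gsqrt (H p) by case/P.
    have Cv := Cn_v_row (oU i) E0 t0 (CH n) (CS0 n) (CS1 n).
    by apply: Cn_ext Cv => // p /P[].
  exists (fun p => w_re (H p) (S0 p) (S1 p)).
  exists (fun p => w_im (H p) (S0 p) (S1 p)).
  split=> [n|n|p /P[]//].
    by apply: Cn_w_re => // p /P[].
  by apply: Cn_w_im => // p /P[].
pose D p := frame i (chart_inv i p).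
exists (fun p => D p *m g (chart_inv i p) *m (D p)^T).
exists (fun p => chart_symbol (D p) (sigma (chart_inv i p)) 0).
exists (fun p => chart_symbol (D p) (sigma (chart_inv i p)) 1).
split=> [|||p ip x].
- exact: metric_smooth.
- exact: symbol_smooth.
- exact: symbol_smooth.
have D0 := frame_det_gt0 ip.
have [E0 t0 _ _] := frame2_row0 (g x) D0.
have [vE wE] := chart_coefficients D0 (sE x).
by split.
Qed.

End Charts.

Theorem corollary14 (R : realType) (X : surface R) (g : riemannian X)
    (compactX : compact [set: X]) (connectedX : connected [set: X])
    (sigma : traceless_symbol g) :
  (exists! vw : (forall x, tangent g x) * (forall x, tangent3 g x),
     [/\ smooth_tangent vw.1, smooth_tangent3 vw.2 &
         forall x xi, sigma x xi = Phi (vw.1 x) (vw.2 x) xi]) /\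
  (forall (v : forall x, tangent g x) (w : forall x, tangent3 g x),
     smooth_tangent v -> smooth_tangent3 w ->
     (forall x xi, sigma x xi = Phi (v x) (w x) xi) ->
     singular_set sigma =
       [set x | v x != 0 /\ tnorm (tdiv (n := 2) (w x) (v x)) = 1]
       `|` [set x | v x = 0 /\ w x = 0]
     /\
     multiplicity_set sigma =
       \bigcup_(x in singular_set sigma)
         [set existT (fun=> 'cV[R]_2) x (flat (g x) z) | z in
            [set z : tangent g x |
               v x != 0 /\ texp 2 z = tdiv (n := 2) (w x) (v x)]]
       `|` [set xi : cotangent X |
              [/\ v (projT1 xi) = 0, w (projT1 xi) = 0 &
                  conorm (g (projT1 xi)) (projT2 xi) = 1]]).
Proof.
split.
  (* The sections are first chosen point by point, with no regularity; [symbol_fields_smooth] then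
     supplies it. *)
  have ex_vw x : exists vw : tangent g x * tangent3 g x,
      forall xi, sigma x xi = Phi vw.1 vw.2 xi.
    have [v [w vwE]] := Phi_surj (symbol_S20 sigma x).
    by exists (v, w).
  have [vw vwE] : {vw : forall x, tangent g x * tangent3 g x |
      forall x xi, sigma x xi = Phi (vw x).1 (vw x).2 xi}.
    by exists (fun x => projT1 (cid (ex_vw x))) => x; case: cid.
  exists (fun x => (vw x).1, fun x => (vw x).2); split=> /=.
    by have [vS wS] := symbol_fields_smooth vwE; split.
  move=> [v w] /= [_ _ vwE']; have eqs x : (vw x).1 = v x /\ (vw x).2 = w x.
    by apply: Phi_inj => xi; rewrite -vwE -vwE'.
  by congr (_, _); apply: functional_extensionality_dep => x; have [] := eqs x.
move=> v w _ _ sE.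
(* Both sets are determined fibre by fibre, so the results on the kernel at a point apply. *)
have singularE x : singular_set sigma x <->
    (v x != 0 /\ tnorm (tdiv (n := 2) (w x) (v x)) = 1) \/ (v x = 0 /\ w x = 0).
  rewrite -Phi_kernel /singular_set /=.
  by split=> -[xi xi0 h]; exists xi => //; move: h; rewrite sE.
split; first by apply/seteqP; split=> x /singularE.
apply/seteqP; split=> [[x xi]|[x xi]].
  rewrite /multiplicity_set /= sE => /Phi_unit_kernel[[z [v0 n1 zE <-]]|?].
    by left; exists x; [apply/singularE; left|exists z].
  by right.
move=> [[y /singularE yS [z [v0 zE] <-]]|]; rewrite /multiplicity_set /= sE.
  apply/Phi_unit_kernel; left; exists z; split=> //.
  (* At a singular point with v nonzero only the alternative |w/v| = 1 remains. *)
  by case: yS => [[]//|[vy _]]; rewrite vy eqxx in v0.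
by move=> ?; apply/Phi_unit_kernel; right.
Qed.
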